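(* For every set of formulas $\Gamma$ and every formula $\phi$: if $\Gamma\vdash_{\mathbf{SU}}\phi$ then $\Gamma\vDash_{\mathbf{SU}}\phi$.
   Context: Formulas are built from countably many propositional variables and $\bot$ with $\land,\lor,\to$; $\neg\alpha$ abbreviates $\alpha\to\bot$. $\vdash_{\mathbf{SU}}$ is the consequence relation of the Hilbert system for intuitionistic propositional logic (with modus ponens) extended by all substitution instances of $\boldsymbol{su} = ((\neg p\to q)\land(\neg q\to p) \rightarrow r \vee s) \to ( p \rightarrow r) \vee(q \rightarrow s)$ as axioms; $\Gamma\vdash_{\mathbf{SU}}\phi$ means $\phi$ is derivable from assumptions in $\Gamma$. For an $\mathbf{S4}$ frame $\langle W,R\rangle$ ($R$ reflexive and transitive) and $X\subseteq W$ put $\mathord{\uparrow}X=\{w:\exists x\in X,\ xRw\}$, $\Diamond X=\{w:\exists x\in X,\ wRx\}$, $\Box X=\{w:\forall v(wRv\Rightarrow v\in X)\}$. A point $z$ strongly unites $x_0,x_1$ if $zRx_0$, $zRx_1$, $z\in\Box(\mathord{\uparrow}\{x_0\}\cup\Diamond\mathord{\uparrow}\{x_1\})$ and $z\in\Box(\mathord{\uparrow}\{x_1\}\cup\Diamond\mathord{\uparrow}\{x_0\})$. The frame satisfies $(su_2)$ if for every $w$ and all $x_0,x_1$ with $wRx_0$, $wRx_1$ there is $z$ with $wRz$ strongly uniting $x_0,x_1$. $\Gamma\vDash_{\mathbf{SU}}\phi$ means: for every $\mathbf{S4}$ frame satisfying $(su_2)$, every upward-closed valuation and every point, if all formulas of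 $\Gamma$ are true at the point (intuitionistic Kripke semantics) then $\phi$ is true there. *)

(* Defs.v *)
From Stdlib Require Export Ensembles.

Inductive formula : Type :=
| Var (n : nat)
| Bot
| And (a b : formula)
| Or (a b : formula)
| Imp (a b : formula).

Definition Neg (a : formula) : formula := Imp a Bot.

Fixpoint subst (s : nat -> formula) (a : formula) : formula :=
  match a with
  | Var n => s n
  | Bot => Bot
  | And a b => And (subst s a) (subst s b)
  | Or a b => Or (subst s a) (subst s b)
  | Imp a b => Imp (subst s a) (subst s b)
  end.

(* ((~p -> q) /\ (~q -> p) -> r \/ s) -> (p -> r) \/ (q -> s) *)
Definition su : formula :=
  let p := Var 0 in let q := Var 1 in let r := Var 2 in let s := Var 3 in
  Imp (Imp (And (Imp (Neg p) q) (Imp (Neg q) p)) (Or r s))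
      (Or (Imp p r) (Imp q s)).

Inductive IPC_axiom : formula -> Prop :=
| ax_K a b : IPC_axiom (Imp a (Imp b a))
| ax_S a b c :
    IPC_axiom (Imp (Imp a (Imp b c)) (Imp (Imp a b) (Imp a c)))
| ax_and_l a b : IPC_axiom (Imp (And a b) a)
| ax_and_r a b : IPC_axiom (Imp (And a b) b)
| ax_and_i a b : IPC_axiom (Imp a (Imp b (And a b)))
| ax_or_l a b : IPC_axiom (Imp a (Or a b))
| ax_or_r a b : IPC_axiom (Imp b (Or a b))
| ax_or_e a b c :
    IPC_axiom (Imp (Imp a c) (Imp (Imp b c) (Imp (Or a b) c)))
| ax_bot a : IPC_axiom (Imp Bot a).

Inductive SU_derives (Gamma : Ensemble formula) : formula -> Prop :=
| der_hyp a : In formula Gamma a -> SU_derives Gamma a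
| der_ipc a : IPC_axiom a -> SU_derives Gamma a
| der_su (sigma : nat -> formula) : SU_derives Gamma (subst sigma su)
| der_mp a b :
    SU_derives Gamma (Imp a b) -> SU_derives Gamma a -> SU_derives Gamma b.

Record S4_frame : Type := {
  world :> Type;
  acc : world -> world -> Prop;
  acc_refl : forall w, acc w w;
  acc_trans : forall u v w, acc u v -> acc v w -> acc u w
}.

Arguments acc {F} _ _ : rename.

Definition Up {F : S4_frame} (X : Ensemble F) : Ensemble F :=
  fun w => exists x, In F X x /\ acc x w.

Definition Dia {F : S4_frame} (X : Ensemble F) : Ensemble F :=
  fun w => exists x, In F X x /\ acc w x.

Definition Box {F : S4_frame} (X : Ensemble F) : Ensemble F :=
  fun w => forall v, acc w v -> In F X v.

Definition strongly_unites {F : S4_frame} (z x0 x1 : F) : Prop :=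
  acc z x0 /\ acc z x1 /\
  In F (Box (Union F (Up (Singleton F x0)) (Dia (Up (Singleton F x1))))) z /\
  In F (Box (Union F (Up (Singleton F x1)) (Dia (Up (Singleton F x0))))) z.

Definition su_2 (F : S4_frame) : Prop :=
  forall w x0 x1 : F, acc w x0 -> acc w x1 ->
    exists z : F, acc w z /\ strongly_unites z x0 x1.

Definition upward_closed {F : S4_frame} (X : Ensemble F) : Prop :=
  forall x y : F, acc x y -> In F X x -> In F X y.

Fixpoint forces {F : S4_frame} (V : nat -> Ensemble F) (w : F) (a : formula)
  : Prop :=
  match a with
  | Var n => In F (V n) w
  | Bot => False
  | And a b => forces V w a /\ forces V w b
  | Or a b => forces V w a \/ forces V w b
  | Imp a b => forall v : F, acc w v -> forces V v a -> forces V v b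
  end.

Definition SU_entails (Gamma : Ensemble formula) (phi : formula) : Prop :=
  forall (F : S4_frame), su_2 F ->
  forall (V : nat -> Ensemble F), (forall n, upward_closed (V n)) ->
  forall w : F,
    (forall a, In formula Gamma a -> forces V w a) -> forces V w phi.

(* Main.v *)
(** The only non-intuitionistic case is [su]. If [p -> r] fails at [x0] and
    [q -> s] fails at [x1], both above [w], take [z] above [w] strongly uniting
    [x0] and [x1]. Each point above [z] is above [x1], hence forces [q], or sees
    a point above [x0], hence refutes [~p]; so [z] forces [~p -> q], and
    symmetrically [~q -> p]. Thus [z] forces [r] or [s], which persists to [x0]
    or [x1] respectively: a contradiction. *)
Require Import Defs.
From Stdlib Require Import Classical.

Section Soundness.

Context {F : S4_frame} (V : nat -> Ensemble F)
  (V_up : forall n, upward_closed (V n)).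

Lemma forces_persistent a (w v : F) :
  acc w v -> forces V w a -> forces V v a.
Proof.
  revert w v; induction a as [n| |a IHa b IHb|a IHa b IHb|a IHa b IHb];
    intros w v Hwv; simpl.
  - apply V_up; exact Hwv.
  - tauto.
  - intros [Ha Hb]; split; eauto.
  - intros [Ha|Hb]; eauto.
  - intros H u Hvu; apply H; eapply acc_trans; eauto.
Qed.

Lemma forces_IPC_axiom a (w : F) : IPC_axiom a -> forces V w a.
Proof.
  intros []; simpl.
  - intros v _ Ha u Hvu _; eapply forces_persistent; eauto.
  - intros v _ H u Hvu Hab t Hut Ha.
    apply (H t); eauto using acc_refl, acc_trans.
  - tauto.
  - tauto.
  - intros v _ Ha u Hvu Hb; split; [eapply forces_persistent|]; eauto.
  - tauto.
  - tauto.
  - intros v _ Hac u Hvu Hbc t Hut [Ha|Hb]; eauto using acc_trans.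
  - tauto.
Qed.

(** Classical logic supplies the refuting points that [su_2] is later applied to. *)
Lemma forces_not_Imp a b (w : F) :
  ~ forces V w (Imp a b) ->
  exists v : F, acc w v /\ forces V v a /\ ~ forces V v b.
Proof.
  intros H; apply NNPP; intros Hn; apply H; intros v Hwv Ha.
  apply NNPP; intros Hb; apply Hn; eauto.
Qed.

(** Stated for one box condition only, so that swapping [x] and [y] yields both conjuncts of the
    premise of [su]. *)
Lemma forces_Neg_Imp (p q : formula) (z x y : F) :
  In F (Box (Union F (Up (Singleton F y)) (Dia (Up (Singleton F x))))) z ->
  forces V x p -> forces V y q -> forces V z (Imp (Neg p) q).
Proof.
  intros HBox Hp Hq v Hzv Hnp.
  destruct (HBox v Hzv) as [? [? [[] Hyv]]|? [u [[? [[] Hxu]] Hvu]]].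
  - exact (forces_persistent q _ _ Hyv Hq).
  - destruct (Hnp u Hvu (forces_persistent p _ _ Hxu Hp)).
Qed.

Lemma forces_su (sigma : nat -> formula) (w : F) :
  su_2 F -> forces V w (subst sigma su).
Proof.
  intros HF v _ H; apply NNPP; intros Hn.
  apply not_or_and in Hn; destruct Hn as [H0 H1].
  apply forces_not_Imp in H0; destruct H0 as [x0 [Hvx0 [Hp Hr]]].
  apply forces_not_Imp in H1; destruct H1 as [x1 [Hvx1 [Hq Hs]]].
  destruct (HF v x0 x1 Hvx0 Hvx1) as [z [Hvz [Hz0 [Hz1 [HB0 HB1]]]]].
  (* The box with [Up] of [x1] gives [~p -> q]; the one with [Up] of [x0] gives [~q -> p]. *)
  destruct (H z Hvz (conj (forces_Neg_Imp _ _ _ _ _ HB1 Hp Hq)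
                          (forces_Neg_Imp _ _ _ _ _ HB0 Hq Hp))) as [Hzr|Hzs].
  - exact (Hr (forces_persistent _ _ _ Hz0 Hzr)).
  - exact (Hs (forces_persistent _ _ _ Hz1 Hzs)).
Qed.

End Soundness.

Theorem theorem2 (Gamma : Ensemble formula) (phi : formula) :
  SU_derives Gamma phi -> SU_entails Gamma phi.
Proof.
  intros H F HF V HV w HGamma.
  induction H as [a Ha|a Ha|sigma|a b _ IHab _ IHa].
  - auto.
  - apply forces_IPC_axiom; assumption.
  - apply forces_su; assumption.
  (* Reflexivity lets the implication be used at [w] itself. *)
  - apply (IHab w); [apply acc_refl|exact IHa].
Qed.
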